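(* Let $t_0\in\mathbb{R}$, let $b:[t_0,\infty)\to\mathbb{R}$ be continuous and let $k:[t_0,\infty)\to\mathbb{R}$ be differentiable. Suppose that there exists a constant $\alpha>0$ such that for all $t\ge t_0$ $$-k(t)\ge\alpha\qquad\text{and}\qquad k'(t)+2b(t)k(t)\le 0,$$ and that there exist positive constants $\alpha_3$ and $t_3$ such that, for all $t\ge t_0$ with $t\ge t_3$, $$-k'(t)-2b(t)k(t)\ge \frac1t\,\alpha_3\, b(t)^2k(t)^2.$$ Then the zero solution of $u''(t)+b(t)u'(t)+k(t)u(t)=0$ on $[t_0,\infty)$ is unstable.
   Context: The zero solution of the second-order equation is called stable if for each $\epsilon>0$ there exists $\delta=\delta(\epsilon,t_0)>0$ such that every solution $u$ on $[t_0,\infty)$ with $u(t_0)^2+u'(t_0)^2<\delta^2$ satisfies $u(t)^2+u'(t)^2<\epsilon^2$ for all $t\ge t_0$. It is called unstable if it is not stable. The initial time $t_0$ is fixed. *)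

(* Defs.v *)
From Stdlib Require Export Reals.
Open Scope R_scope.

Definition halfline (t0 t : R) : Prop := t0 <= t.

(* Functions on [t0, oo) are represented by total functions R -> R whose values
   to the left of t0 are never used: [continue_in] and [D_in] only look at
   points of the given domain, so both are one-sided at t0. *)
Definition continuous_on (D : R -> Prop) (f : R -> R) : Prop :=
  forall t, D t -> continue_in f D t.

Definition derivative_on (D : R -> Prop) (f df : R -> R) : Prop :=
  forall t, D t -> D_in f df D t.

(* [du] and [ddu] are the first and second derivatives of [u]. *)
Definition is_solution (b k : R -> R) (t0 : R) (u du ddu : R -> R) : Prop :=
  derivative_on (halfline t0) u du /\
  derivative_on (halfline t0) du ddu /\
  forall t, t0 <= t -> ddu t + b t * du t + k t * u t = 0.

Definition zero_stable (b k : R -> R) (t0 : R) : Prop :=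
  forall eps, 0 < eps ->
  exists delta, 0 < delta /\
  forall u du ddu : R -> R,
    is_solution b k t0 u du ddu ->
    u t0 ^ 2 + du t0 ^ 2 < delta ^ 2 ->
    forall t, t0 <= t -> u t ^ 2 + du t ^ 2 < eps ^ 2.

Definition zero_unstable (b k : R -> R) (t0 : R) : Prop :=
  ~ zero_stable b k t0.

(* Main.v *)
From Stdlib Require Import Reals Lra Lia Classical_Prop.
From Coquelicot Require Import Coquelicot.
Require Import Defs.
Open Scope R_scope.

(** Why the zero solution is unstable.

    Write y = u'. Where k < 0, the quantity E = - y^2 / k - u^2 has derivative
    E' = y^2 (k' + 2 b k) / k^2 <= 0 along solutions ([energy_derive]). Take the
    solution with u(t0) = delta / 2 and y(t0) = 0. Then u^2 >= - E >= u(t0)^2 at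
    all later times, so u can never reach zero and stays above delta / 2
    ([stays_above_initial_value]). Hence the restoring term - k u pushes y
    upwards at a rate at least m = alpha delta / 2, and only the friction b y
    can prevent y from growing linearly.

    If the zero solution were stable, u and y would remain smaller than 1, so E
    would be bounded below and its total decrease after some time T would be as
    small as desired ([small_remaining_decrease]). The last hypothesis says
    that - E' >= (alpha3 / t) (b y)^2, so the total of (b y)^2 / t after T is
    small too. By the Cauchy-Schwarz inequality the integral of b y over [T, t]
    is then at most a small multiple of t, which cannot compensate m t: y is
    unbounded, a contradiction. To avoid integrals, Cauchy-Schwarz is used in
    its additive form: with lam = t / m,

      b y <= (lam / s) (b y)^2 + s / (4 lam),

    which makes y - (lam / alpha3) E - m s + s^2 / (8 lam) nondecreasing in s
    on [T, t].

    Instability also requires the solution to exist on the whole half-line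
    ([linear_second_order_global_solution]). The Picard iterates converge
    geometrically on all of R in the norm weighted by exp(2 A) + exp(- 2 A),
    where A is a primitive of 1 + |b| + |k|. The coefficients are
    first extended to R by their values at t0, and the solution on R is then
    restricted. *)

(** * Monotonicity from the sign of the derivative *)

Lemma continuity_of_is_derive (f df : R -> R) :
  (forall t, is_derive f t (df t)) -> continuity f.
Proof.
  intros Hf t. apply derivable_continuous_pt.
  exists (df t). apply is_derive_Reals, Hf.
Qed.

Lemma nondecreasing_of_derive_nonneg (f df : R -> R) (a b : R) :
  a <= b ->
  (forall x, a <= x <= b -> continuity_pt f x) ->
  (forall x, a < x < b -> is_derive f x (df x)) ->
  (forall x, a <= x <= b -> 0 <= df x) ->
  f a <= f b.
Proof.
  intros Hab Hc Hd Hp.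
  destruct (MVT_gen f a b df) as [c [Hc1 Hc2]];
    rewrite ?Rmin_left, ?Rmax_right in * by lra; auto.
  pose proof (Hp c Hc1). nra.
Qed.

(** Valid for t on either side of t0, so that the estimates for an initial
    value problem need not treat the past and the future separately. *)
Lemma increment_abs_le (H S h s : R -> R) (t0 t : R) :
  (forall x, is_derive H x (h x)) -> (forall x, is_derive S x (s x)) ->
  (forall x, Rabs (h x) <= s x) ->
  Rabs (H t - H t0) <= Rabs (S t - S t0).
Proof.
  intros HH HS Hle.
  assert (Hs : forall x, - s x <= h x <= s x).
  { intro x. apply Rabs_le_between, Hle. }
  assert (Hm : forall x, is_derive (fun y => S y - H y) x (s x - h x)).
  { intro x. apply (is_derive_minus (V := R_NormedModule)); auto. }
  assert (Hp : forall x, is_derive (fun y => S y + H y) x (s x + h x)).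
  { intro x. apply (is_derive_plus (V := R_NormedModule)); auto. }
  assert (Hmono : forall a b, a <= b -> Rabs (H b - H a) <= S b - S a).
  { intros a b Hab. apply Rabs_le_between.
    assert (S a - H a <= S b - H b).
    { apply (nondecreasing_of_derive_nonneg (fun y => S y - H y)
               (fun y => s y - h y)); auto.
      { intros x _. now apply (continuity_of_is_derive _ (fun y => s y - h y)). }
      intros x _. specialize (Hs x). lra. }
    assert (S a + H a <= S b + H b).
    { apply (nondecreasing_of_derive_nonneg (fun y => S y + H y)
               (fun y => s y + h y)); auto.
      { intros x _. now apply (continuity_of_is_derive _ (fun y => s y + h y)). }
      intros x _. specialize (Hs x). lra. }
    lra. }
  destruct (Rle_dec t0 t) as [Ht|Ht].
  - eapply Rle_trans; [apply Hmono, Ht | apply Rle_abs].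
  - rewrite (Rabs_minus_sym (H t)), (Rabs_minus_sym (S t)).
    eapply Rle_trans; [apply Hmono; lra | apply Rle_abs].
Qed.

(** * Geometric convergence *)

(** The bound after p steps is kept in the telescoped form
    2 K / 2^n - 2 K / 2^(n+p), which makes the induction on p close. *)
Lemma geometric_steps_converge (x : nat -> R) (K : R) :
  (forall n, Rabs (x (S n) - x n) <= K / 2 ^ n) ->
  is_lim_seq x (Finite (Lim_seq x)) /\
  forall n, Rabs (x n - Lim_seq x) <= 2 * K / 2 ^ n.
Proof.
  intros Hx.
  assert (H2 : forall n, 0 < 2 ^ n) by (intro n; apply pow_lt; lra).
  assert (HK : 0 <= K).
  { specialize (Hx 0%nat). simpl in Hx.
    pose proof (Rabs_pos (x 1%nat - x 0%nat)). lra. }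
  assert (Htail : forall n p,
    Rabs (x (n + p)%nat - x n) <= 2 * K / 2 ^ n - 2 * K / 2 ^ (n + p)).
  { intros n p. induction p as [|p IH].
    - rewrite Nat.add_0_r, !Rminus_diag, Rabs_R0. lra.
    - rewrite Nat.add_succ_r.
      replace (x (S (n + p)) - x n)
        with ((x (S (n + p)) - x (n + p)%nat) + (x (n + p)%nat - x n)) by ring.
      eapply Rle_trans; [apply Rabs_triang|].
      specialize (Hx (n + p)%nat).
      replace (2 * K / 2 ^ S (n + p)) with (K / 2 ^ (n + p)).
      2: { simpl. field. specialize (H2 (n + p)%nat). lra. }
      replace (2 * K / 2 ^ (n + p)) with (K / 2 ^ (n + p) + K / 2 ^ (n + p)) in IH
        by (field; specialize (H2 (n + p)%nat); lra).
      specialize (H2 (n + p)%nat). lra. }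
  assert (Hbd : forall n p, Rabs (x (n + p)%nat - x n) <= 2 * K / 2 ^ n).
  { intros n p. specialize (Htail n p).
    assert (0 <= 2 * K / 2 ^ (n + p)).
    { apply Rdiv_le_0_compat; [lra | apply H2]. }
    lra. }
  assert (Hgeom : is_lim_seq (fun n => 2 * K / 2 ^ n) 0).
  { replace (Finite 0) with (Rbar_mult (2 * K) 0)
      by (simpl; f_equal; ring).
    apply is_lim_seq_ext with (fun n => 2 * K * (/ 2) ^ n).
    - intro n. unfold Rdiv. now rewrite pow_inv.
    - apply is_lim_seq_scal_l, is_lim_seq_geom.
      rewrite Rabs_pos_eq; lra. }
  assert (Hlim : is_lim_seq x (Finite (Lim_seq x))).
  { apply Lim_seq_correct'. apply ex_lim_seq_cauchy_corr.
    intro eps.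
    apply is_lim_seq_spec in Hgeom.
    destruct (Hgeom (pos_div_2 eps)) as [N HN].
    exists N. intros n m Hn Hm.
    specialize (HN N (Nat.le_refl N)). simpl in HN.
    rewrite Rminus_0_r in HN.
    apply Rle_lt_trans with (1 := Rle_abs _) in HN.
    pose proof (Hbd N (n - N)%nat) as E1. pose proof (Hbd N (m - N)%nat) as E2.
    replace (N + (n - N))%nat with n in E1 by lia.
    replace (N + (m - N))%nat with m in E2 by lia.
    replace (x n - x m) with ((x n - x N) - (x m - x N)) by ring.
    eapply Rle_lt_trans; [apply Rabs_triang|]. rewrite Rabs_Ropp. lra. }
  split; [exact Hlim|]. intro n.
  rewrite Rabs_minus_sym.
  assert (Hl : is_lim_seq (fun p => Rabs (x (p + n)%nat - x n))
                 (Rabs (Lim_seq x - x n))).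
  { apply (is_lim_seq_abs _ (Finite (Lim_seq x - x n))).
    apply is_lim_seq_minus'; [|apply is_lim_seq_const].
    now apply is_lim_seq_incr_n. }
  refine (is_lim_seq_le _ (fun _ => 2 * K / 2 ^ n) _ _ _ Hl (is_lim_seq_const _)).
  intro p. rewrite Nat.add_comm. apply Hbd.
Qed.

(** A continuous G is bounded on the compact ball, which turns a weighted
    estimate on R into locally uniform convergence. *)
Lemma CVU_of_geometric_bound (f : nat -> R -> R) (g G : R -> R) (c : R) (r : posreal) :
  continuity G ->
  (forall n t, Rabs (f n t - g t) <= G t / 2 ^ n) ->
  CVU f g c r.
Proof.
  intros HG Hf eps Heps.
  destruct (continuity_ab_maj G (c - r) (c + r)) as [M [HM _]].
  { pose proof (cond_pos r). lra. }
  { intros; apply HG. }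
  destruct (pow_lt_1_zero (/ 2) ltac:(rewrite Rabs_pos_eq; lra)
              (eps / (Rabs (G M) + 1))) as [N HN].
  { apply Rdiv_lt_0_compat; [lra|]. pose proof (Rabs_pos (G M)); lra. }
  exists N. intros n y Hn Hy.
  specialize (HN n Hn).
  assert (Hpos : 0 < (/ 2) ^ n) by (apply pow_lt; lra).
  rewrite (Rabs_pos_eq ((/ 2) ^ n)) in HN by lra.
  assert (HGy : G y <= Rabs (G M)).
  { eapply Rle_trans; [|apply Rle_abs]. apply HM.
    unfold Boule in Hy. apply Rabs_lt_between in Hy. lra. }
  rewrite Rabs_minus_sym.
  eapply Rle_lt_trans; [apply Hf|].
  unfold Rdiv. rewrite <- pow_inv.
  pose proof (Rabs_pos (G M)) as H0.
  apply Rmult_lt_compat_r with (r := Rabs (G M) + 1) in HN; [|lra].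
  replace (eps / (Rabs (G M) + 1) * (Rabs (G M) + 1)) with eps in HN
    by (field; lra).
  nra.
Qed.

(** * Global solutions of linear equations *)

Lemma is_derive_primitive (f : R -> R) (t0 c t : R) :
  continuity f -> is_derive (fun x => c + RInt f t0 x) t (f t).
Proof.
  intro Hf.
  replace (f t) with (0 + f t) by ring.
  apply (is_derive_plus (V := R_NormedModule) (fun _ => c)); [exact (is_derive_const (K := R_AbsRing) (V := R_NormedModule) c t)|].
  apply is_derive_RInt with t0.
  - apply filter_forall. intro x. apply (RInt_correct (V := R_CompleteNormedModule)).
    apply ex_RInt_continuous. intros z _.
    apply continuity_pt_filterlim, Hf.
  - apply continuity_pt_filterlim, Hf.
Qed.

Section Picard.

Variables (b k : R -> R) (t0 u0 v0 : R).
Hypotheses (Hb : continuity b) (Hk : continuity k).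

(** Picard iterates for (u, u') of u'' = - b u' - k u. Starting from zero rather
    than from (u0, v0) makes the first step the constant (u0, v0), whose bound
    is immediate. *)
Fixpoint picard (n : nat) : (R -> R) * (R -> R) :=
  match n with
  | O => (fun _ => 0, fun _ => 0)
  | S n =>
      (fun t => u0 + RInt (snd (picard n)) t0 t,
       fun t => v0 + RInt (fun s => - b s * snd (picard n) s - k s * fst (picard n) s) t0 t)
  end.

Let U n := fst (picard n).
Let Y n := snd (picard n).

Lemma picard_continuity n : continuity (U n) /\ continuity (Y n).
Proof.
  induction n as [|n [IHU IHY]].
  - split; apply continuity_const; intros ? ?; reflexivity.
  - split.
    + apply (continuity_of_is_derive _ (Y n)).
      intro t. now apply (is_derive_primitive (Y n)).
    + apply (continuity_of_is_derive _ (fun s => - b s * Y n s - k s * U n s)).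
      intro t. apply (is_derive_primitive (fun s => - b s * Y n s - k s * U n s)).
      apply continuity_minus; apply continuity_mult; auto.
      now apply continuity_opp.
Qed.

Lemma picard_derive n t :
  is_derive (U (S n)) t (Y n t) /\
  is_derive (Y (S n)) t (- b t * Y n t - k t * U n t).
Proof.
  destruct (picard_continuity n) as [HU HY]. split.
  - now apply (is_derive_primitive (Y n)).
  - apply (is_derive_primitive (fun s => - b s * Y n s - k s * U n s)).
    apply continuity_minus; apply continuity_mult; auto.
    now apply continuity_opp.
Qed.

Lemma picard_init n : U (S n) t0 = u0 /\ Y (S n) t0 = v0.
Proof.
  unfold U, Y; simpl. rewrite !RInt_point. unfold zero; simpl. lra.
Qed.

(* [a] bounds the operator norm of the system in the maximum norm. The weight
   [W] is symmetric in [A], hence large on both sides of [t0]. *)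
Let a (t : R) : R := 1 + Rabs (b t) + Rabs (k t).
Let A (t : R) : R := RInt a t0 t.
Let W (t : R) : R := exp (2 * A t) + exp (- (2 * A t)).

Lemma a_continuity : continuity a.
Proof.
  intro t. unfold a.
  apply (continuity_pt_plus (fun t => 1 + Rabs (b t))).
  - apply (continuity_pt_plus (fun _ => 1)).
    + now apply continuity_pt_const.
    + apply (continuity_pt_comp b Rabs); [apply Hb | apply Rcontinuity_abs].
  - apply (continuity_pt_comp k Rabs); [apply Hk | apply Rcontinuity_abs].
Qed.

Lemma A_derive t : is_derive A t (a t).
Proof.
  apply is_derive_ext with (fun x => 0 + RInt a t0 x).
  - intro x. exact (Rplus_0_l _).
  - apply is_derive_primitive, a_continuity.
Qed.

Lemma W_continuity : continuity W.
Proof.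
  apply (continuity_of_is_derive _
    (fun t => 2 * a t * exp (2 * A t) - 2 * a t * exp (- (2 * A t)))).
  intro t. unfold W. pose proof (A_derive t) as HA.
  auto_derive.
  - repeat split; exists (a t); exact HA.
  - rewrite (is_derive_unique (fun x : R => A x) t (a t)) by exact HA. ring.
Qed.

(** The contraction estimate. The derivative of (exp(2 A) - exp(- 2 A)) / 2 is
    a W, and its absolute value is at most W / 2: integrating a C W from t0
    therefore gives back half of the bound C W. *)
Lemma picard_weight_integral (C : R) (H h : R -> R) (t : R) :
  0 <= C -> H t0 = 0 ->
  (forall x, is_derive H x (h x)) ->
  (forall x, Rabs (h x) <= a x * (C * W x)) ->
  Rabs (H t) <= C / 2 * W t.
Proof.
  intros HC H0 HH Hh.
  set (S := fun x => C / 2 * (exp (2 * A x) - exp (- (2 * A x)))).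
  assert (HS : forall x, is_derive S x (a x * (C * W x))).
  { intro x. unfold S, W. pose proof (A_derive x) as HA.
    auto_derive.
    - repeat split; exists (a x); exact HA.
    - rewrite (is_derive_unique (fun x : R => A x) x (a x)) by exact HA. field. }
  pose proof (increment_abs_le H S h _ t0 t HH HS Hh) as Hle.
  assert (HA0 : A t0 = 0) by (unfold A; now rewrite RInt_point).
  rewrite H0, Rminus_0_r in Hle.
  eapply Rle_trans; [exact Hle|].
  unfold S, W. rewrite HA0, Rmult_0_r, Ropp_0, exp_0.
  replace (C / 2 * (exp (2 * A t) - exp (- (2 * A t))) - C / 2 * (1 - 1))
    with (C / 2 * (exp (2 * A t) - exp (- (2 * A t)))) by ring.
  rewrite Rabs_mult, (Rabs_pos_eq (C / 2)) by lra.
  apply Rmult_le_compat_l; [lra|].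
  pose proof (exp_pos (2 * A t)). pose proof (exp_pos (- (2 * A t))).
  apply Rabs_le_between. lra.
Qed.

Lemma W_ge_1 t : 1 <= W t.
Proof.
  unfold W. pose proof (exp_ineq1_le (2 * A t)).
  pose proof (exp_ineq1_le (- (2 * A t))). lra.
Qed.

Lemma coefficient_bound (B u y : R) t :
  Rabs u <= B -> Rabs y <= B ->
  Rabs y <= a t * B /\ Rabs (- b t * y - k t * u) <= a t * B.
Proof.
  intros Hu Hy. unfold a.
  pose proof (Rabs_pos (b t)). pose proof (Rabs_pos (k t)).
  pose proof (Rabs_pos u). pose proof (Rabs_pos y).
  split; [nra|].
  unfold Rminus. eapply Rle_trans; [apply Rabs_triang|].
  rewrite Rabs_Ropp, !Rabs_mult, Rabs_Ropp. nra.
Qed.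

Let C := Rabs u0 + Rabs v0.

Lemma picard_step n t :
  Rabs (U (S n) t - U n t) <= C / 2 ^ n * W t /\
  Rabs (Y (S n) t - Y n t) <= C / 2 ^ n * W t.
Proof.
  assert (HC : 0 <= C).
  { unfold C. pose proof (Rabs_pos u0). pose proof (Rabs_pos v0). lra. }
  revert t. induction n as [|n IH]; intro t.
  - pose proof (W_ge_1 t).
    pose proof (Rabs_pos u0). pose proof (Rabs_pos v0).
    unfold U, Y; cbn [picard fst snd].
    assert (HI : RInt (fun _ : R => 0) t0 t = 0).
    { rewrite RInt_const. apply Rmult_0_r. }
    rewrite (RInt_ext (fun s => - b s * 0 - k s * 0) (fun _ => 0))
      by (intros; simpl; ring).
    rewrite HI, !Rplus_0_r, !Rminus_0_r. simpl. unfold C in *.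
    split; nra.
  - assert (H2 : 0 < 2 ^ n) by (apply pow_lt; lra).
    assert (HCn : 0 <= C / 2 ^ n) by (apply Rdiv_le_0_compat; lra).
    replace (C / 2 ^ S n) with (C / 2 ^ n / 2) by (simpl; field; lra).
    destruct (picard_init n) as [EU EY]. destruct (picard_init (S n)) as [EU' EY'].
    split.
    + apply (picard_weight_integral _ (fun t => U (S (S n)) t - U (S n) t)
              (fun t => Y (S n) t - Y n t)); auto.
      * rewrite EU, EU'. ring.
      * intro x. apply (is_derive_minus (V := R_NormedModule)); apply picard_derive.
      * intro x. destruct (IH x) as [IU IY].
        apply (proj1 (coefficient_bound _ _ _ x IU IY)).
    + apply (picard_weight_integral _ (fun t => Y (S (S n)) t - Y (S n) t)
              (fun t => - b t * (Y (S n) t - Y n t) - k t * (U (S n) t - U n t))); auto.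
      * rewrite EY, EY'. ring.
      * intro x.
        replace (- b x * (Y (S n) x - Y n x) - k x * (U (S n) x - U n x))
          with ((- b x * Y (S n) x - k x * U (S n) x)
                - (- b x * Y n x - k x * U n x)) by ring.
        apply (is_derive_minus (V := R_NormedModule)); apply picard_derive.
      * intro x. destruct (IH x) as [IU IY].
        apply (proj2 (coefficient_bound _ _ _ x IU IY)).
Qed.

(** The iterates and their derivatives converge locally uniformly, because the
    derivatives are linear in the iterates with coefficients bounded by a. So
    the equation passes to the limit. *)
Theorem linear_second_order_global_solution :
  exists u y : R -> R,
    u t0 = u0 /\ y t0 = v0 /\
    (forall t, is_derive u t (y t)) /\
    (forall t, is_derive y t (- b t * y t - k t * u t)).
Proof.
  set (u := fun t => real (Lim_seq (fun n => U n t))).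
  set (y := fun t => real (Lim_seq (fun n => Y n t))).
  assert (Hu : forall t, is_lim_seq (fun n => U n t) (u t) /\
            forall n, Rabs (U n t - u t) <= 2 * (C * W t) / 2 ^ n).
  { intro t. apply (geometric_steps_converge (fun n => U n t)). intro n.
    replace (C * W t / 2 ^ n) with (C / 2 ^ n * W t)
      by (field; apply pow_nonzero; lra).
    apply picard_step. }
  assert (Hy : forall t, is_lim_seq (fun n => Y n t) (y t) /\
            forall n, Rabs (Y n t - y t) <= 2 * (C * W t) / 2 ^ n).
  { intro t. apply (geometric_steps_converge (fun n => Y n t)). intro n.
    replace (C * W t / 2 ^ n) with (C / 2 ^ n * W t)
      by (field; apply pow_nonzero; lra).
    apply picard_step. }
  assert (HG : continuity (fun t => 2 * (C * W t))).
  { apply continuity_scal with (f := fun t => C * W t).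
    apply continuity_scal with (f := W). apply W_continuity. }
  assert (HaG : continuity (fun t => a t * (2 * (C * W t)))).
  { apply continuity_mult with (f1 := a); [apply a_continuity | exact HG]. }
  set (one := mkposreal 1 Rlt_0_1).
  assert (Hself : forall t, Boule t one t).
  { intro t. unfold Boule. rewrite Rminus_diag, Rabs_R0. simpl. lra. }
  assert (Ucv : forall c, CVU U u c one).
  { intro c. eapply CVU_of_geometric_bound; [exact HG|]. intros; apply Hu. }
  assert (Ycv : forall c, CVU Y y c one).
  { intro c. eapply CVU_of_geometric_bound; [exact HG|]. intros; apply Hy. }
  assert (Hinit : forall (x : nat -> R) c, (forall n, x (S n) = c) -> real (Lim_seq x) = c).
  { intros x c Hx. rewrite <- Lim_seq_incr_1.
    rewrite (Lim_seq_ext _ (fun _ => c)); auto. now rewrite Lim_seq_const. }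
  exists u, y. split; [|split; [|split]].
  - apply Hinit. intro n. apply picard_init.
  - apply Hinit. intro n. apply picard_init.
  - intro t. apply is_derive_Reals.
    apply (CVU_derivable (fun n => U (S n)) Y u y t one); auto.
    + intros x _. apply is_lim_seq_Reals.
      apply -> (is_lim_seq_incr_1 (fun n => U n x)). apply Hu.
    + intros n x _. apply is_derive_Reals, picard_derive.
  - intro t. apply is_derive_Reals.
    apply (CVU_derivable (fun n => Y (S n))
             (fun n t => - b t * Y n t - k t * U n t) y
             (fun t => - b t * y t - k t * u t) t one); auto.
    + eapply CVU_of_geometric_bound; [exact HaG|]. intros n x.
      replace (- b x * Y n x - k x * U n x - (- b x * y x - k x * u x))
        with (- b x * (Y n x - y x) - k x * (U n x - u x)) by ring.
      unfold Rdiv. rewrite Rmult_assoc.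
      apply (proj2 (coefficient_bound _ _ _ x (proj2 (Hu x) n) (proj2 (Hy x) n))).
    + intros x _. apply is_lim_seq_Reals.
      apply -> (is_lim_seq_incr_1 (fun n => Y n x)). apply Hy.
    + intros n x _. apply is_derive_Reals, picard_derive.
Qed.

End Picard.

(** * One-sided derivatives on a half-line *)

Lemma Rmax_lipschitz (c x y : R) : Rabs (Rmax c x - Rmax c y) <= Rabs (x - y).
Proof.
  unfold Rmax, Rabs. destruct (Rle_dec c x), (Rle_dec c y);
    repeat destruct Rcase_abs; lra.
Qed.

(** Composing with [Rmax t0] extends by the value at t0, and turns one-sided
    continuity into continuity. *)
Lemma continuity_extension (t0 : R) (f : R -> R) :
  continuous_on (halfline t0) f -> continuity (fun t => f (Rmax t0 t)).
Proof.
  intros Hf x eps Heps.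
  destruct (Hf (Rmax t0 x) (Rmax_l _ _) eps Heps) as [d [Hd H]].
  exists d. split; [exact Hd|]. intros y [_ Hy].
  simpl in *. unfold Rdist in *.
  destruct (Req_dec (Rmax t0 x) (Rmax t0 y)) as [E|E].
  - rewrite E, Rminus_diag, Rabs_R0. exact Heps.
  - apply H. split.
    + split; [apply Rmax_l | exact E].
    + eapply Rle_lt_trans; [apply Rmax_lipschitz | exact Hy].
Qed.

(** The point t0 is excluded: the constant extension may have a corner there. *)
Lemma derive_extension (t0 : R) (f df : R -> R) (t : R) :
  derivative_on (halfline t0) f df -> t0 < t ->
  is_derive (fun s => f (Rmax t0 s)) t (df t).
Proof.
  intros Hf Ht. apply is_derive_Reals. intros eps Heps.
  destruct (Hf t (Rlt_le _ _ Ht) eps Heps) as [d [Hd H]].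
  assert (Hm : 0 < Rmin d (t - t0)) by (apply Rmin_glb_lt; lra).
  exists (mkposreal _ Hm). simpl. intros h Hh0 Hh.
  pose proof (Rmin_l d (t - t0)). pose proof (Rmin_r d (t - t0)).
  apply Rabs_lt_between in Hh as Hh'.
  rewrite !Rmax_right by lra.
  specialize (H (t + h)). simpl in H. unfold Rdist, D_x, halfline in H.
  replace (t + h - t) with h in H by ring.
  apply H. repeat split; lra.
Qed.

Lemma derivative_on_of_is_derive (D : R -> Prop) (f df : R -> R) :
  (forall t, D t -> is_derive f t (df t)) -> derivative_on D f df.
Proof.
  intros Hf t Ht eps Heps.
  destruct (proj1 (is_derive_Reals _ _ _) (Hf t Ht) eps Heps) as [d H].
  exists d. split; [apply cond_pos|]. intros x [[_ Hne] Hx].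
  simpl in *. unfold Rdist in *.
  specialize (H (x - t)). replace (t + (x - t)) with x in H by ring.
  apply H; [lra | exact Hx].
Qed.

(** * Instability *)

(** Along solutions the terms u u' cancel: the weight - 1 / k is chosen so that
    the force - k u contributes 2 u u' to the first term. Only friction and the
    variation of k remain. *)
Lemma energy_derive (u y k : R -> R) (t b dk : R) :
  is_derive u t (y t) -> is_derive y t (- b * y t - k t * u t) ->
  is_derive k t dk -> k t <> 0 ->
  is_derive (fun s => - (y s ^ 2 / k s) - u s ^ 2) t
    (y t ^ 2 * (dk + 2 * b * k t) / k t ^ 2).
Proof.
  intros Du Dy Dk Hk.
  auto_derive.
  - repeat split; try (eexists; eassumption). exact Hk.
  - rewrite (is_derive_unique (fun x : R => u x) t _ Du),
            (is_derive_unique (fun x : R => y x) t _ Dy),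
            (is_derive_unique (fun x : R => k x) t _ Dk).
    field. exact Hk.
Qed.

(** A bounded monotone function converges; T is a time at which E is within eta
    of its infimum. *)
Lemma small_remaining_decrease (E : R -> R) (t0 t1 m eta : R) :
  (forall s t, t0 <= s -> s <= t -> E t <= E s) ->
  (forall t, t0 <= t -> m <= E t) ->
  0 < eta ->
  exists T, t0 <= T /\ t1 <= T /\ forall t, T <= t -> E T - E t <= eta.
Proof.
  intros Hdec Hm Heta.
  destruct (completeness (fun x => exists t, t0 <= t /\ x = - E t)) as [L [HL1 HL2]].
  - exists (- m). intros x [t [Ht ->]]. specialize (Hm t Ht). lra.
  - exists (- E t0), t0. split; lra.
  - destruct (classic (exists t, t0 <= t /\ L - eta < - E t))
      as [[T0 [HT0 HT]]|Hno].
    + exists (Rmax T0 t1).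
      pose proof (Rmax_l T0 t1). pose proof (Rmax_r T0 t1).
      repeat split; try lra. intros t Ht.
      pose proof (Hdec T0 (Rmax T0 t1) HT0 ltac:(lra)).
      assert (- E t <= L) by (apply HL1; exists t; split; lra).
      lra.
    + exfalso. assert (L <= L - eta); [|lra].
      apply HL2. intros x [t [Ht ->]].
      destruct (Rle_dec (- E t) (L - eta)) as [Hle|Hle]; [exact Hle|].
      exfalso. apply Hno. exists t. split; lra.
Qed.

(** To fall below its initial value, u would first have to become nonpositive,
    hence to vanish at some point, where its square is too small. *)
Lemma stays_above_initial_value (u : R -> R) (t0 t : R) :
  continuity u -> 0 < u t0 ->
  (forall s, t0 <= s -> u t0 ^ 2 <= u s ^ 2) ->
  t0 <= t -> u t0 <= u t.
Proof.
  intros Hc H0 Hsq Ht.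
  destruct (Rle_dec (u t0) (u t)) as [Hle|Hlt]; [exact Hle|exfalso].
  pose proof (Hsq t Ht).
  assert (Hneg : u t <= 0) by nra.
  destruct (IVT_gen u t0 t 0 Hc) as [z [Hz Ez]].
  { rewrite Rmin_right, Rmax_left by lra. lra. }
  rewrite Rmin_left, Rmax_right in Hz by lra.
  pose proof (Hsq z (proj1 Hz)). rewrite Ez in *. nra.
Qed.

Theorem theorem4p3 (t0 : R) (b k dk : R -> R)
  (hb : continuous_on (halfline t0) b)
  (hk : derivative_on (halfline t0) k dk)
  (h1 : exists alpha, 0 < alpha /\
        forall t, t0 <= t -> - k t >= alpha /\ dk t + 2 * b t * k t <= 0)
  (h2 : exists alpha3 t3, 0 < alpha3 /\ 0 < t3 /\
        forall t, t0 <= t -> t3 <= t ->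
        - dk t - 2 * b t * k t >= 1 / t * alpha3 * b t ^ 2 * k t ^ 2) :
  zero_unstable b k t0.
Proof.
  intro Hst.
  destruct h1 as [alpha [Halpha h1]].
  destruct h2 as [a3 [t3 [Ha3 [Ht3 h2]]]].
  destruct (Hst 1 Rlt_0_1) as [delta [Hdelta Hbound]]. clear Hst.
  assert (Cb : continuity (fun t => b (Rmax t0 t))) by now apply continuity_extension.
  assert (Ck : continuity (fun t => k (Rmax t0 t))).
  { apply continuity_extension. intros t Ht. apply cont_deriv with dk, hk, Ht. }
  destruct (linear_second_order_global_solution _ _ t0 (delta / 2) 0 Cb Ck)
    as [u [y [Eu [Ey [Du Dy]]]]].
  assert (Hmax : forall t, t0 <= t -> Rmax t0 t = t) by (intros; now apply Rmax_right).
  assert (Hsmall : forall t, t0 <= t -> u t ^ 2 + y t ^ 2 < 1 ^ 2).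
  { apply (Hbound u y (fun t => - b (Rmax t0 t) * y t - k (Rmax t0 t) * u t)).
    - repeat split.
      + apply derivative_on_of_is_derive; auto.
      + apply derivative_on_of_is_derive; auto.
      + intros t Ht. rewrite !Hmax by assumption. ring.
    - rewrite Eu, Ey. nra. }
  assert (Cu : continuity u) by exact (continuity_of_is_derive _ _ Du).
  assert (Cy : continuity y) by exact (continuity_of_is_derive _ _ Dy).
  assert (Hkneg : forall t, k (Rmax t0 t) <= - alpha).
  { intro t. destruct (h1 (Rmax t0 t) (Rmax_l _ _)). lra. }
  (* dE is the derivative of E for t > t0 only, but its sign is known at t0 too,
     as the mean value theorem on [t0, t] requires. *)
  set (E := fun t => - (y t ^ 2 / k (Rmax t0 t)) - u t ^ 2).
  set (dE := fun t => y t ^ 2 * (dk t + 2 * b t * k t) / k t ^ 2).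
  assert (CE : continuity E).
  { intro t. unfold E. specialize (Hkneg t).
    apply (continuity_pt_minus (fun t => - (y t ^ 2 / k (Rmax t0 t)))).
    - apply (continuity_pt_opp (fun t => y t ^ 2 / k (Rmax t0 t))).
      apply (continuity_pt_div (fun t => y t ^ 2)); [|apply Ck|lra].
      apply (continuity_pt_comp y (fun x => x ^ 2)); [apply Cy|].
      apply derivable_continuous_pt, derivable_pt_pow.
    - apply (continuity_pt_comp u (fun x => x ^ 2)); [apply Cu|].
      apply derivable_continuous_pt, derivable_pt_pow. }
  assert (DE : forall t, t0 < t -> is_derive E t (dE t)).
  { intros t Ht. unfold dE.
    pose proof (derive_extension t0 k dk t hk Ht) as Dk.
    pose proof (energy_derive u y (fun s => k (Rmax t0 s)) t _ _
                  (Du t) (Dy t) Dk) as H.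
    cbv beta in H. rewrite (Hmax t) in H by lra.
    apply H. destruct (h1 t); lra. }
  assert (Edec : forall s t, t0 <= s -> s <= t -> E t <= E s).
  { intros s t Hs Hst. apply Ropp_le_cancel.
    apply (nondecreasing_of_derive_nonneg (fun x => - E x) (fun x => - dE x)); auto.
    - intros x _. apply continuity_pt_opp, CE.
    - intros x Hx. apply (is_derive_opp (V := R_NormedModule)), DE. lra.
    - intros x Hx. destruct (h1 x ltac:(lra)) as [Hk1 Hk2].
      unfold dE, Rdiv.
      assert (0 < / k x ^ 2) by (apply Rinv_0_lt_compat; nra).
      assert (y x ^ 2 * (dk x + 2 * b x * k x) <= 0) by nra.
      nra. }
  assert (Hkin : forall t, 0 <= - (y t ^ 2 / k (Rmax t0 t))).
  { intro t. specialize (Hkneg t).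
    replace (- (y t ^ 2 / k (Rmax t0 t))) with (y t ^ 2 / (- k (Rmax t0 t)))
      by (field; lra).
    apply Rdiv_le_0_compat; nra. }
  assert (Hu : forall t, t0 <= t -> delta / 2 <= u t).
  { intros t Ht. rewrite <- Eu. apply stays_above_initial_value; auto; [lra|].
    intros s Hs. pose proof (Edec t0 s (Rle_refl _) Hs) as H. unfold E in H.
    rewrite Ey in H. specialize (Hkin s). unfold Rdiv in H.
    replace (0 ^ 2 * / k (Rmax t0 t0)) with 0 in H by ring.
    unfold Rdiv in Hkin. lra. }
  set (m := alpha * (delta / 2)).
  assert (Hm : 0 < m) by (apply Rmult_lt_0_compat; lra).
  destruct (small_remaining_decrease E t0 t3 (- 1) (m ^ 2 * a3 / 8)) as [T [HT0 [HT3 HT]]].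
  { exact Edec. }
  { intros t Ht. specialize (Hkin t). specialize (Hsmall t Ht). unfold E. nra. }
  { apply Rdiv_lt_0_compat; [|lra]. apply Rmult_lt_0_compat; nra. }
  (* At this time the lower bound for y t is 2: the tail of E and the quadratic
     term of F each cost m t / 8, and 3/4 m t - m T - 1 = 2. *)
  set (t := 4 / 3 * (T + 3 / m)).
  assert (H3m : 0 < 3 / m) by (apply Rdiv_lt_0_compat; lra).
  assert (HTt : T < t) by (unfold t; lra).
  set (lam := t / m).
  assert (Hlam : 0 < lam) by (apply Rdiv_lt_0_compat; lra).
  set (F := fun s => y s - lam / a3 * E s - m * s + s ^ 2 / (8 * lam)).
  assert (HF : F T <= F t).
  { apply (nondecreasing_of_derive_nonneg F (fun s =>
      (- b s * y s - k s * u s) - lam / a3 * dE s - m + s / (4 * lam))).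
    - lra.
    - intros x _. unfold F.
      apply continuity_pt_plus with (f1 := fun s => y s - lam / a3 * E s - m * s).
      + apply continuity_pt_minus with (f1 := fun s => y s - lam / a3 * E s).
        * apply continuity_pt_minus; [apply Cy|].
          apply continuity_pt_scal, CE.
        * apply continuity_pt_scal, derivable_continuous_pt, derivable_pt_id.
      + apply continuity_pt_mult with (f1 := fun s => s ^ 2).
        * apply derivable_continuous_pt, derivable_pt_pow.
        * now apply continuity_pt_const.
    - intros x Hx. unfold F.
      pose proof (DE x ltac:(lra)) as DEx. pose proof (Dy x) as Dyx.
      auto_derive.
      + repeat split; eexists; eassumption.
      + rewrite (is_derive_unique (fun x : R => E x) x _ DEx),
                (is_derive_unique (fun x : R => y x) x _ Dyx).
        rewrite Hmax by lra. field. lra.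
    - intros x Hx.
      destruct (h1 x ltac:(lra)) as [Hk1 _].
      pose proof (h2 x ltac:(lra) ltac:(lra)) as Hk2.
      pose proof (Hu x ltac:(lra)) as Hux.
      assert (Hforce : m <= - k x * u x) by (unfold m; nra).
      assert (Hdrop : a3 / x * (b x * y x) ^ 2 <= - dE x).
      { unfold dE.
        replace (a3 / x * (b x * y x) ^ 2)
          with (y x ^ 2 / k x ^ 2 * (1 / x * a3 * b x ^ 2 * k x ^ 2))
          by (field; lra).
        replace (- (y x ^ 2 * (dk x + 2 * b x * k x) / k x ^ 2))
          with (y x ^ 2 / k x ^ 2 * (- dk x - 2 * b x * k x)) by (field; lra).
        apply Rmult_le_compat_l; [|lra].
        apply Rdiv_le_0_compat; nra. }
      assert (Hdrop' : lam / x * (b x * y x) ^ 2 <= - (lam / a3 * dE x)).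
      { replace (lam / x * (b x * y x) ^ 2)
          with (lam / a3 * (a3 / x * (b x * y x) ^ 2)) by (field; lra).
        replace (- (lam / a3 * dE x)) with (lam / a3 * - dE x) by ring.
        apply Rmult_le_compat_l; [|exact Hdrop].
        apply Rlt_le, Rdiv_lt_0_compat; lra. }
      (* The square (2 lam b y - x)^2 is nonnegative. *)
      assert (Hyoung : 0 <= lam / x * (b x * y x) ^ 2 - b x * y x + x / (4 * lam)).
      { replace (lam / x * (b x * y x) ^ 2 - b x * y x + x / (4 * lam))
          with ((2 * lam * (b x * y x) - x) ^ 2 / (4 * lam * x)) by (field; lra).
        apply Rdiv_le_0_compat; [apply pow2_ge_0 | nra]. }
      lra. }
  pose proof (HT t (Rlt_le _ _ HTt)) as Htail.
  assert (HyT : - 1 < y T).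
  { specialize (Hsmall T HT0). nra. }
  assert (Hyt : y t < 1).
  { specialize (Hsmall t ltac:(lra)). nra. }
  unfold F in HF.
  assert (H1 : lam / a3 * (E T - E t) <= m * t / 8).
  { replace (m * t / 8) with (lam / a3 * (m ^ 2 * a3 / 8)) by (unfold lam; field; lra).
    apply Rmult_le_compat_l; [|exact Htail].
    apply Rlt_le, Rdiv_lt_0_compat; lra. }
  assert (H2 : t ^ 2 / (8 * lam) = m * t / 8) by (unfold lam; field; lra).
  assert (H3 : 0 <= T ^ 2 / (8 * lam)) by (apply Rdiv_le_0_compat; nra).
  assert (H4 : 3 / 4 * (m * t) = m * T + 3) by (unfold t; field; lra).
  lra.
Qed.
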